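(* Let $\mathfrak A$ be a first-order structure with universe $A$ and let $N$ be a natural number. Every perfect element of $\mathfrak{Cs}_{\mathrm{IFG}_N}(\mathfrak A)$ belongs to $\mathfrak{Cs}_{\mathrm{IFG}_{N,\emptyset}}(\mathfrak A)$.
   Context: $N$ is identified with $\{0,\dots,N-1\}$; ${}^N\!A$ is the set of valuations $\vec a=(a_0,\dots,a_{N-1})$ in $A$; $\mathscr P$ denotes power set. Syntax. The $\mathrm{IFG}_N$-formulas in the language of $\mathfrak A$ are the smallest set containing all atomic first-order formulas with variables among $v_0,\dots,v_{N-1}$ and closed under: $\phi\mapsto{\sim}\phi$; $(\phi,\psi)\mapsto\phi\lor_{/J}\psi$ for $J\subseteq N$; $\phi\mapsto\exists v_{n/J}\,\phi$ for $n<N$, $J\subseteq N$. Notation. For $J\subseteq N$, $\vec a\approx_J\vec b$ means $\vec a,\vec b$ agree on $N\setminus J$. $V=V_1\cup_JV_2$ means $V=V_1\cup V_2$, $V_1\cap V_2=\emptyset$, and each $V_i$ is closed under $\approx_J$ within $V$. $f\colon V\underset{J}{\to}A$ means $f\colon V\to A$ is a function with $f(\vec a)=f(\vec b)$ whenever $\vec a\approx_J\vec b$. $\vec a(n:b)$ is $\vec a$ with $n$-th coordinate replaced by $b$; $V(n:f)=\{\vec a(n:f(\vec a))\mid\vec a\in V\}$; $V(n:A)=\{\vec a(n:b)\mid\vec a\in V,b\in A\}$. Semantics. For $V\subseteq{}^N\!A$, the relations $\mathfrak A\models^{+}\phi[V]$ and $\mathfrak A\models^-\phi[V]$ (existence of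 winning strategies in the semantic game for the verifier, respectively the falsifier, knowing that the initial valuation is in $V$) are characterized recursively by: - $\phi$ atomic: $\mathfrak A\models^+\phi[V]$ iff $\mathfrak A\models\phi[\vec a]$ for every $\vec a\in V$; $\mathfrak A\models^-\phi[V]$ iff $\mathfrak A\not\models\phi[\vec a]$ for every $\vec a\in V$. - $\mathfrak A\models^+{\sim}\psi[V]$ iff $\mathfrak A\models^-\psi[V]$; $\mathfrak A\models^-{\sim}\psi[V]$ iff $\mathfrak A\models^+\psi[V]$. - $\mathfrak A\models^+\psi_1\lor_{/J}\psi_2[V]$ iff $\mathfrak A\models^+\psi_1[V_1]$ and $\mathfrak A\models^+\psi_2[V_2]$ for some $V=V_1\cup_JV_2$; $\mathfrak A\models^-\psi_1\lor_{/J}\psi_2[V]$ iff $\mathfrak A\models^-\psi_1[V]$ and $\mathfrak A\models^-\psi_2[V]$. - $\mathfrak A\models^+\exists v_{n/J}\psi[V]$ iff $\mathfrak A\models^+\psi[V(n:f)]$ for some $f\colon V\underset{J}{\to}A$; $\mathfrak A\models^-\exists v_{n/J}\psi[V]$ iff $\mathfrak A\models^-\psi[V(n:A)]$. Meanings. $\|\phi\|_{\mathfrak A}=\langle\|\phi\|^+_{\mathfrak A},\|\phi\|^-_{\mathfrak A}\rangle$, where $\|\phi\|^{+}_{\mathfrak A}=\{V\subseteq{}^N\!A\mid\mathfrak A\models^{+}\phi[V]\}$ and $\|\phi\|^{-}_{\mathfrak A}=\{W\subseteq{}^N\!A\mid\mathfrak A\models^{-}\phi[W]\}$. Algebras. On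 pairs $X=\langle X^+,X^-\rangle\in\mathscr P(\mathscr P({}^N\!A))\times\mathscr P(\mathscr P({}^N\!A))$ define: - $0=\langle\{\emptyset\},\mathscr P({}^N\!A)\rangle$, $1=\langle\mathscr P({}^N\!A),\{\emptyset\}\rangle$; - $D_{ij}=\langle\mathscr P(\{\vec a\mid a_i=a_j\}),\mathscr P(\{\vec a\mid a_i\neq a_j\})\rangle$ for $i,j<N$; - $X^{\cup}=\langle X^-,X^+\rangle$; - $X+_JY$ ($J\subseteq N$): $V\in(X+_JY)^+$ iff $V=V_1\cup_JV_2$ for some $V_1\in X^+,V_2\in Y^+$; $(X+_JY)^-=X^-\cap Y^-$; - $X\cdot_JY$ ($J\subseteq N$): $(X\cdot_JY)^+=X^+\cap Y^+$; $W\in(X\cdot_JY)^-$ iff $W=W_1\cup_JW_2$ for some $W_1\in X^-,W_2\in Y^-$; - $C_{n,J}(X)$ ($n<N$, $J\subseteq N$): $V\in C_{n,J}(X)^+$ iff $V(n:f)\in X^+$ for some $f\colon V\underset{J}{\to}A$; $W\in C_{n,J}(X)^-$ iff $W(n:A)\in X^-$. $\mathfrak{Cs}_{\mathrm{IFG}_N}(\mathfrak A)$ is the algebra with these operations whose universe is the set of meanings $\|\phi\|_{\mathfrak A}$ of all $\mathrm{IFG}_N$-formulas $\phi$ in the language of $\mathfrak A$. Its $\emptyset$-reduct is its reduct to $\langle0,1,D_{ij},{}^{\cup},+_\emptyset,\cdot_\emptyset,C_{n,\emptyset}\rangle$ ($i,j,n<N$), and $\mathfrak{Cs}_{\mathrm{IFG}_{N,\emptyset}}(\mathfrak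 A)$ is the subalgebra of this $\emptyset$-reduct generated by the meanings of atomic formulas. An element $X$ is perfect if there is $V\subseteq{}^N\!A$ with $X=\langle\mathscr P(V),\mathscr P({}^N\!A\setminus V)\rangle$. *)

(* Defs.v *)
From mathcomp Require Import all_boot.
From mathcomp Require Import boolp classical_sets.

Set Implicit Arguments.
Unset Strict Implicit.
Unset Printing Implicit Defensive.

Local Open Scope classical_set_scope.

Record language := Language {
  fsym : Type;
  farity : fsym -> nat;
  rsym : Type;
  rarity : rsym -> nat
}.

(* Constants are function symbols of arity 0.  The universe is not required
   to be nonempty. *)
Record structure (L : language) := Structure {
  universe :> Type;
  finterp : forall f : fsym L, ('I_(farity f) -> universe) -> universe;
  rinterp : forall r : rsym L, ('I_(rarity r) -> universe) -> Prop
}.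

Inductive term (L : language) (N : nat) : Type :=
| Var of 'I_N
| App (f : fsym L) of ('I_(farity f) -> term L N).

Inductive atomic (L : language) (N : nat) : Type :=
| Equal of term L N & term L N
| Rel (r : rsym L) of ('I_(rarity r) -> term L N).

Inductive formula (L : language) (N : nat) : Type :=
| Atom of atomic L N
| Neg of formula L N
| Or of {set 'I_N} & formula L N & formula L N
| Ex of 'I_N & {set 'I_N} & formula L N.

Definition valuation (A : Type) (N : nat) : Type := 'I_N -> A.

Section Teams.
Variables (A : Type) (N : nat).
Implicit Types (J : {set 'I_N}) (a b : valuation A N).
Implicit Types (V W : set (valuation A N)).

Definition agree_off J a b : Prop := forall i, i \notin J -> a i = b i.

Definition closed_within J V W : Prop :=
  forall a b, V a -> V b -> agree_off J a b -> W a -> W b.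

(* V = V1 \cup_J V2 *)
Definition splits J V V1 V2 : Prop :=
  [/\ V = V1 `|` V2, V1 `&` V2 = set0,
      closed_within J V V1 & closed_within J V V2].

(* A function from V to A is represented by a total function, of which only
   the restriction to V matters.  In [Ex] and [cyl] a coordinate n : 'I_N is
   available, so that any function on V extends, by a |-> a n outside V, even
   when A is empty. *)
Definition uniform J V (f : valuation A N -> A) : Prop :=
  forall a b, V a -> V b -> agree_off J a b -> f a = f b.

Definition update a (n : 'I_N) (c : A) : valuation A N :=
  fun i => if i == n then c else a i.

Definition update_fun V (n : 'I_N) (f : valuation A N -> A) :
    set (valuation A N) :=
  [set update a n (f a) | a in V].

Definition update_all V (n : 'I_N) : set (valuation A N) :=
  [set update a n c | a in V & c in [set: A]].

End Teams.

Section Semantics.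
Variables (L : language) (A : structure L) (N : nat).

Fixpoint eval_term (a : valuation A N) (t : term L N) : A :=
  match t with
  | Var i => a i
  | App f ts => finterp (fun k => eval_term a (ts k))
  end.

Definition holds (p : atomic L N) (a : valuation A N) : Prop :=
  match p with
  | Equal s t => eval_term a s = eval_term a t
  | Rel r ts => rinterp (fun k => eval_term a (ts k))
  end.

Fixpoint sat_pos (phi : formula L N) (V : set (valuation A N))
    {struct phi} : Prop :=
  match phi with
  | Atom p => forall a, V a -> holds p a
  | Neg psi => sat_neg psi V
  | Or J psi1 psi2 =>
      exists V1 V2, [/\ splits J V V1 V2, sat_pos psi1 V1 & sat_pos psi2 V2]
  | Ex n J psi =>
      exists f, uniform J V f /\ sat_pos psi (update_fun V n f)
  end
with sat_neg (phi : formula L N) (V : set (valuation A N))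
    {struct phi} : Prop :=
  match phi with
  | Atom p => forall a, V a -> ~ holds p a
  | Neg psi => sat_pos psi V
  | Or J psi1 psi2 => sat_neg psi1 V /\ sat_neg psi2 V
  | Ex n J psi => sat_neg psi (update_all V n)
  end.

End Semantics.

(* The pairs X = (X^+, X^-). *)
Definition meanings (A : Type) (N : nat) : Type :=
  (set (set (valuation A N)) * set (set (valuation A N)))%type.

Section Operations.
Variables (A : Type) (N : nat).
Implicit Types (X Y : meanings A N) (J : {set 'I_N}).

Definition subsets (V : set (valuation A N)) : set (set (valuation A N)) :=
  [set W | W `<=` V].

Definition zero : meanings A N := ([set set0], subsets setT).

Definition one : meanings A N := (subsets setT, [set set0]).

Definition diag (i j : 'I_N) : meanings A N :=
  (subsets [set a | a i = a j], subsets [set a | a i <> a j]).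

Definition dual X : meanings A N := (X.2, X.1).

Definition plus J X Y : meanings A N :=
  ([set V | exists V1 V2, [/\ splits J V V1 V2, X.1 V1 & Y.1 V2]],
   X.2 `&` Y.2).

Definition times J X Y : meanings A N :=
  (X.1 `&` Y.1,
   [set W | exists W1 W2, [/\ splits J W W1 W2, X.2 W1 & Y.2 W2]]).

Definition cyl (n : 'I_N) J X : meanings A N :=
  ([set V | exists f, uniform J V f /\ X.1 (update_fun V n f)],
   [set W | X.2 (update_all W n)]).

Definition perfect X : Prop :=
  exists V : set (valuation A N), X = (subsets V, subsets (~` V)).

(* Closure under the operations, constants included, of the reduct in which
   every slash set is empty. *)
Record empty_reduct_closed (S : set (meanings A N)) : Prop := {
  closed_zero : S zero;
  closed_one : S one;
  closed_diag : forall i j, S (diag i j);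
  closed_dual : forall X, S X -> S (dual X);
  closed_plus : forall X Y, S X -> S Y -> S (plus finset.set0 X Y);
  closed_times : forall X Y, S X -> S Y -> S (times finset.set0 X Y);
  closed_cyl : forall n X, S X -> S (cyl n finset.set0 X)
}.

End Operations.

Section CylindricSetAlgebras.
Variables (L : language) (A : structure L) (N : nat).

Definition meaning (phi : formula L N) : meanings A N :=
  ([set V | sat_pos phi V], [set W | sat_neg phi W]).

Definition Cs_IFG : set (meanings A N) := range meaning.

(* Generated inside all pairs rather than inside [Cs_IFG]: the latter contains
   the constants and is closed under the operations, except when N = 0 and
   there are no closed atomic formulas, in which case it is empty. *)
Definition Cs_IFG_empty : set (meanings A N) :=
  smallest (@empty_reduct_closed A N) (range (fun p => meaning (Atom p))).

End CylindricSetAlgebras.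

Arguments Cs_IFG {L} A N _.
Arguments Cs_IFG_empty {L} A N _.

(* Main.v *)
Require Import Defs.
From mathcomp Require Import all_boot.
From mathcomp Require Import boolp classical_sets.

Set Implicit Arguments.
Unset Strict Implicit.
Unset Printing Implicit Defensive.

Local Open Scope classical_set_scope.

(** Let T be the set of valuations satisfying the first-order formula obtained
    from phi by erasing all slashes.  A team that wins phi for the verifier is
    included in T, and one that wins phi for the falsifier is disjoint from T,
    so if phi has the perfect meaning given by V then V is included in T and
    its complement in the complement of T; hence V = T.  The perfect pair given
    by T is built from atomic meanings with the dual and the operations
    [plus] and [cyl] with empty slash set, which act on perfect pairs as
    complement, union and cylindrification. *)

Section PerfectPairs.
Variables (A : Type) (N : nat).
Implicit Types (T U V : set (valuation A N)).

Definition perfect_pair T : meanings A N := (subsets T, subsets (~` T)).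

Definition cylindrify (n : 'I_N) T : set (valuation A N) :=
  [set a | exists c, T (update a n c)].

Lemma agree_off0 (a b : valuation A N) : agree_off finset.set0 a b -> a = b.
Proof. by move=> ab; apply/funext => i; apply: ab; rewrite inE. Qed.

Lemma dual_perfect_pair T : dual (perfect_pair T) = perfect_pair (~` T).
Proof. by rewrite /dual /perfect_pair setCK. Qed.

Lemma plus_perfect_pair T U :
  plus finset.set0 (perfect_pair T) (perfect_pair U) = perfect_pair (T `|` U).
Proof.
congr pair; apply/seteqP; split=> V /=.
- case=> V1 [V2 [[-> _ _ _] V1T V2U]] a.
  by case=> [/V1T|/V2U]; [left|right].
(* Points in both [T] and [U] go to the first part; with an empty slash set, closure of the parts is
   trivial. *)
- move=> VTU; exists (V `&` T), (V `\` T); split.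
  + split.
    * by rewrite setUIDK.
    * by rewrite setDE setIACA setICr setI0.
    * by move=> a b _ _ /agree_off0 ->.
    * by move=> a b _ _ /agree_off0 ->.
  + by move=> a [].
  + by move=> a [/VTU []].
- by case=> VT VU a Va []; [exact: VT|exact: VU].
- by move=> VTU; split=> a /VTU nTU ?; apply: nTU; [left|right].
Qed.

Lemma cyl_perfect_pair n T :
  cyl n finset.set0 (perfect_pair T) = perfect_pair (cylindrify n T).
Proof.
congr pair; apply/seteqP; split=> V /=.
- by case=> f [_ fT] a Va; exists (f a); apply: fT; exists a.
- move=> VT.
  (* Outside [V] the default [a n] is used, so [A] may be empty. *)
  have choose_c (a : valuation A N) : {c | V a -> T (update a n c)}.
    apply: cid; have [/VT [c Tc]|nVa] := pselect (V a); first by exists c.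
    by exists (a n).
  exists (fun a => sval (choose_c a)); split.
    by move=> a b _ _ /agree_off0 ->.
  by move=> _ [a Va <-]; exact: (svalP (choose_c a)).
- by move=> VT a Va [c]; apply: VT; exists a => //; exists c.
- by move=> VT _ [a Va [c _ <-]] Tc; apply: (VT a Va); exists c.
Qed.

End PerfectPairs.

Section SlashFreeTruth.
Variables (L : language) (A : structure L) (N : nat).
Implicit Types (phi : formula L N) (V : set (valuation A N)).

Fixpoint truth_set phi : set (valuation A N) :=
  match phi with
  | Atom p => [set a | holds p a]
  | Neg psi => ~` truth_set psi
  | Or _ psi1 psi2 => truth_set psi1 `|` truth_set psi2
  | Ex n _ psi => cylindrify n (truth_set psi)
  end.

(** Both halves go by one induction, since [Neg] swaps them. Slashes only restrict the verifier's
    splittings and choices, so ignoring them preserves the inclusions. *)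
Lemma sat_truth_set phi V :
  (sat_pos phi V -> V `<=` truth_set phi) /\
  (sat_neg phi V -> V `<=` ~` truth_set phi).
Proof.
elim: phi V => [p|psi IH|J psi1 IH1 psi2 IH2|n J psi IH] V //=.
- by rewrite setCK; split; [exact: (IH V).2|exact: (IH V).1].
- split=> [[V1 [V2 [[-> _ _ _] /(IH1 _).1 V1T /(IH2 _).1 V2T]]]|].
    exact: setUSS.
  by case=> /(IH1 _).2 VT1 /(IH2 _).2 VT2; rewrite setCU subsetI.
- split=> [[f [_ /(IH _).1 fT]] a Va|/(IH _).2 VT a Va [c]].
    by exists (f a); apply: fT; exists a.
  by apply: VT; exists a => //; exists c.
Qed.

Lemma truth_set_in_Cs_IFG_empty phi :
  Cs_IFG_empty A N (perfect_pair (truth_set phi)).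
Proof.
move=> S [Sclosed Satoms].
elim: phi => [p|psi IH|J psi1 IH1 psi2 IH2|n J psi IH] /=.
(* The meaning of an atom is by definition a perfect pair. *)
- by apply: Satoms; exists p.
- by rewrite -dual_perfect_pair; exact: closed_dual.
- by rewrite -plus_perfect_pair; exact: closed_plus.
- by rewrite -cyl_perfect_pair; exact: closed_cyl.
Qed.

End SlashFreeTruth.

Theorem proposition3p7 (L : language) (A : structure L) (N : nat)
    (X : meanings A N) (hX : Cs_IFG A N X) (hperf : perfect X) :
  Cs_IFG_empty A N X.
Proof.
case: hperf hX => V -> [phi _ [posE negE]].
suff -> : V = truth_set phi by exact: truth_set_in_Cs_IFG_empty.
(* By perfection, [V] itself wins for the verifier and its complement for the falsifier. *)
have /(sat_truth_set _ _).1 sub_V : [set W | sat_pos phi W] V by rewrite posE.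
have /(sat_truth_set _ _).2 sub_VC : [set W | sat_neg phi W] (~` V).
  by rewrite negE.
by apply/seteqP; split=> //; apply/subsetCP.
Qed.
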